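(* Let $A\in\mathbb{B}(\mathscr{H})$ and let $B\in\mathbb{B}(\mathscr{H})$ be self-adjoint. If $A$ has closed range, then the following statements are equivalent: (1) the system of operator equations $BXA=B=AXB$ is solvable, i.e. there exists $X\in\mathbb{B}(\mathscr{H})$ with $BXA=B$ and $AXB=B$; (2) $AA^\dagger BA^\dagger A=B$; (3) $\mathscr{R}(B)\subseteq\mathscr{R}(A)$ and $\mathscr{R}(B)\subseteq\mathscr{R}(A^* )$.
   Context: $\mathscr{H}$ is a complex Hilbert space, $\mathbb{B}(\mathscr{H})$ is the space of bounded linear operators on $\mathscr{H}$, and $\mathscr{R}(\cdot)$ denotes the range. For a closed range operator $A$, $A^\dagger\in\mathbb{B}(\mathscr{H})$ is its Moore--Penrose inverse, the unique operator with $AA^\dagger A=A$, $A^\dagger AA^\dagger=A^\dagger$, $(AA^\dagger)^*=AA^\dagger$, $(A^\dagger A)^*=A^\dagger A$. *)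

(* Defs.v *)
From HB Require Import structures.
From mathcomp Require Import all_boot all_order all_algebra.
From mathcomp Require Import sesquilinear complex.
From mathcomp Require Import all_classical all_reals topology normedtype.

Set Implicit Arguments.
Unset Strict Implicit.
Unset Printing Implicit Defensive.

Import Order.TTheory GRing.Theory Num.Theory.
Import numFieldNormedType.Exports.

Local Open Scope classical_set_scope.
Local Open Scope ring_scope.

HB.mixin Record CompleteNormedModule_isHilbert (R : realType) H
    of CompleteNormedModule R[i] H := {
  hdot : {dot H for Num.conj} ;
  hdot_norm : forall x : H, hdot x x = `|x| ^+ 2
}.

#[short(type="hilbertType")]
HB.structure Definition Hilbert (R : realType) :=
  {H of CompleteNormedModule_isHilbert R H & CompleteNormedModule R[i] H}.

Section operators.
Variables (R : realType) (H : hilbertType R).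
Implicit Types A T X : H -> H.

Definition bounded_op : set (H -> H) :=
  [set T | linear T /\ bounded_near T (nbhs (0 : H))].

(* Only meaningful for bounded [A], where such a [T] exists (Riesz) and is
   unique; [get] returns a default value when there is none. *)
Definition adjoint A : H -> H :=
  get [set T | bounded_op T /\ forall x y, hdot (A x) y = hdot x (T y)].

Definition self_adjoint A : Prop := adjoint A = A.

Definition penrose A X : Prop :=
  [/\ A \o X \o A = A,
      X \o A \o X = X,
      adjoint (A \o X) = A \o X
    & adjoint (X \o A) = X \o A].

(* Only meaningful for bounded [A] with closed range, where such an [X] exists
   and is unique; [get] returns a default value when there is none. *)
Definition mpinv A : H -> H := get [set X | bounded_op X /\ penrose A X].

End operators.

(* Main.v *)
Require Import Defs.
From HB Require Import structures.
From mathcomp Require Import all_boot all_order all_algebra.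
From mathcomp Require Import sesquilinear complex.
From mathcomp Require Import lra.
From mathcomp Require Import all_classical all_reals topology normedtype.

Set Implicit Arguments.
Unset Strict Implicit.
Unset Printing Implicit Defensive.

Import Order.TTheory GRing.Theory Num.Theory.
Import numFieldNormedType.Exports.

Local Open Scope classical_set_scope.
Local Open Scope ring_scope.

(** The equivalence is short algebra once adjoints and the Moore-Penrose inverse
X of A are known to exist. AX is the orthogonal projection onto the range of A
and XA the one onto the range of the adjoint A*. If BYA = B = AYB, then AX and
XA act as identities, AXB = AXAYB = B and BXA = BYAXA = B, which gives (2). As B
is self-adjoint, taking adjoints in (2) gives B = XABAX, and XA = A*X*, so (2)
places the range of B inside both ranges. Conversely, when the range of B lies
in those of A and of A*, X itself solves the system: AXB = B because AX fixes
the range of A, and BXA = B is the adjoint of XAB = B.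

The substance is therefore existence. Adjoints come from the Riesz
representation theorem ([riesz_representation]), itself a consequence of the
projection theorem ([nearest_point], [orthogonal_projection]): a minimizing
sequence in a closed subspace is Cauchy by the parallelogram law.

For a bounded A with closed range, X y is defined as the unique x orthogonal to
the kernel of A with A x = P y, where P projects onto the range of A. Only its
boundedness is delicate, and it amounts to a bound |x| <= C |A x| for x
orthogonal to the kernel ([bounded_below_on_coimage]). That bound is reached
through the adjoint. Let S be the set of the w in the range of A with
|A* w| <= 1. For every y, writing P y = A x, one has
|<y, w>| = |<x, A* w>| <= |x| on S, so S is weakly bounded, hence norm bounded
by the uniform boundedness principle ([weakly_bounded_bounded]); this says
|w| <= C |A* w| on the range of A ([adjoint_bounded_below]). It follows that A*
maps the range of A onto a closed subspace, which is the whole orthogonal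
complement of the kernel; so x there is A* w with |w| <= C |x|, and
|x|^2 = <A x, w> gives the bound.

All estimates are carried out with the real-valued norm [nrm], since the norm
of the space takes its values in the complex numbers, where the order is only
partial. *)

(** * The real-valued norm *)

Definition nrm (R : rcfType) (V : normedZmodType R[i]) (x : V) : R :=
  complex.Re `|x|.

Section RealNorm.
Variables (R : rcfType) (V : normedZmodType R[i]).
Implicit Types (x y z : V).
Local Open Scope complex_scope.

Lemma nrmE x : `|x| = (nrm x)%:C.
Proof. by rewrite RRe_real// normr_real. Qed.

Lemma nrm_ge0 x : 0 <= nrm x.
Proof. by rewrite -ler0c -nrmE. Qed.

Lemma nrm0 : nrm (0 : V) = 0. Proof. by rewrite /nrm normr0. Qed.

Lemma nrm0_eq0 x : nrm x = 0 -> x = 0.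
Proof. by move=> x0; apply/eqP; rewrite -normr_eq0 nrmE x0. Qed.

Lemma nrm_gt0 x : x != 0 -> 0 < nrm x.
Proof.
move=> x0; rewrite lt_neqAle nrm_ge0 andbT eq_sym.
by apply: contra_neq x0 => /nrm0_eq0.
Qed.

Lemma nrmD x y : nrm (x + y) <= nrm x + nrm y.
Proof. by rewrite -lecR rmorphD/= -!nrmE ler_normD. Qed.

Lemma nrmN x : nrm (- x) = nrm x.
Proof. by rewrite /nrm normrN. Qed.

Lemma nrmBC x y : nrm (x - y) = nrm (y - x).
Proof. by rewrite /nrm distrC. Qed.

Lemma nrm_dist y x z : nrm (x - z) <= nrm (x - y) + nrm (y - z).
Proof. by rewrite -[x - z](subrKA y) nrmD. Qed.

End RealNorm.

Section RealNormScalar.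
Variables (R : rcfType) (V : normedModType R[i]).
Implicit Types (x : V) (a b : R[i]).
Local Open Scope complex_scope.

Lemma nrmZ a x : nrm (a *: x) = nrm a * nrm x.
Proof. by apply: (@complexI R); rewrite rmorphM/= -!nrmE normrZ. Qed.

Lemma nrm_real (r : R) : nrm (r%:C : R[i]) = `|r|.
Proof. by rewrite /nrm normc_def/= expr0n/= addr0 sqrtr_sqr. Qed.

Lemma nrmM a b : nrm (a * b) = nrm a * nrm b.
Proof. by apply: (@complexI R); rewrite rmorphM/= -!nrmE normrM. Qed.

End RealNormScalar.

(** * Topology through the real-valued norm *)

Section RealTopology.
Variables (R : realType) (V : completeNormedModType R[i]).
Implicit Types (x y z : V) (M : set V).
Local Open Scope complex_scope.

(** Radii of balls are complex numbers; a positive one is real, so real radii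
    are enough. *)
Lemma nbhs_nrmP (W : normedModType R[i]) (x : W) (A : set W) :
  nbhs x A <-> exists2 e : R, 0 < e & forall y : W, nrm (x - y) < e -> A y.
Proof.
split=> [/nbhs_normP[e /= e0 eA]|[e e0 eA]].
  have eE : e = (complex.Re e)%:C by rewrite RRe_real// gtr0_real.
  exists (complex.Re e) => [|y xy]; first by rewrite -ltcR -eE.
  by apply: eA => /=; rewrite eE nrmE ltcR.
apply/nbhs_normP; exists e%:C => /=; first by rewrite ltcR.
by move=> y /=; rewrite nrmE ltcR => /eA.
Qed.

Lemma closed_nrmP M :
  closed M <-> forall x,
    (forall e : R, 0 < e -> exists2 m, M m & nrm (x - m) < e) -> M x.
Proof.
split=> [Mcl x xM|Mcl x xM].
  apply: Mcl => A /nbhs_nrmP[e e0 eA].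
  by have [m Mm xm] := xM e e0; exists m; split => //; exact: eA.
apply: Mcl => e e0.
have [m [Mm em]] : M `&` [set y | nrm (x - y) < e] !=set0.
  by apply: xM; apply/nbhs_nrmP; exists e.
by exists m.
Qed.

Lemma cauchy_nrm_cvg (u : nat -> V) :
  (forall e : R, 0 < e -> exists N, forall n m, (N <= n)%N -> (N <= m)%N ->
     nrm (u n - u m) < e) ->
  exists l, forall e : R, 0 < e -> exists N, forall n, (N <= n)%N ->
     nrm (u n - l) < e.
Proof.
move=> uC.
have : cauchy (u @ \oo).
  apply/cauchy_exP => e e0.
  have eE : e = (complex.Re e)%:C by rewrite RRe_real// gtr0_real.
  have /uC[N uN] : 0 < complex.Re e by rewrite -ltcR -eE.
  exists (u N); exists N => // n /= Nn.
  by rewrite -ball_normE /ball_/= eE nrmE ltcR uN.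
move=> /cauchy_cvg/cvg_ex[l ul]; exists l => e e0.
have /ul[N _ uN] : nbhs l [set y | nrm (l - y) < e].
  by apply/nbhs_nrmP; exists e.
by exists N => n /uN /=; rewrite nrmBC.
Qed.

End RealTopology.

Lemma invS_lt (R : archiRealFieldType) (e : R) : 0 < e ->
  exists N, forall n, (N <= n)%N -> n.+1%:R^-1 < e.
Proof.
move=> e0; exists (Num.truncn e^-1) => n Nn.
by rewrite invf_plt ?posrE// (lt_le_trans (truncnS_gt _))// ler_nat ltnS.
Qed.

(** * Bounded operators *)

Section BoundedOperators.
Variables (R : realType) (H : hilbertType R).
Implicit Types (x y z : H) (M : set H) (A B T : H -> H).
Local Open Scope complex_scope.

Let pack_linear T (lT : linear T) : {linear H -> H} :=
  HB.pack T (GRing.isLinear.Build _ _ _ _ _ lT).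

Lemma bounded_opP T :
  bounded_op T <->
    linear T /\ exists2 C : R, 0 <= C & forall x, nrm (T x) <= C * nrm x.
Proof.
split=> [[lT bT]|[lT [C C0 TC]]]; split=> //.
  have [r r0 rT] := pinfty_ex_gt0 ((linear_boundedP (pack_linear lT)).1 bT).
  have rE : r = (complex.Re r)%:C by rewrite RRe_real// gtr0_real.
  exists (complex.Re r) => [|x]; first by rewrite -ler0c -rE ltW.
  rewrite -lecR rmorphM/= -rE -!nrmE.
  exact: rT.
apply: (linear_boundedP (pack_linear lT)).2.
exists C%:C; split; first by rewrite complex_real.
move=> r Cr x /=; apply: (@le_trans _ _ (C%:C * `|x|)).
  by rewrite !nrmE -rmorphM/= lecR.
by rewrite ler_wpM2r// ltW.
Qed.

Lemma linear_opB T : linear T -> {morph T : x y / x - y}.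
Proof. by move=> lT x y; exact: (linearB (pack_linear lT)). Qed.

Lemma linear_opZ T : linear T -> forall a, {morph T : x / a *: x}.
Proof. by move=> lT a x; exact: (@linearZ_LR _ _ _ _ (pack_linear lT)). Qed.

Lemma linear_op0 T : linear T -> T 0 = 0.
Proof. by move=> lT; exact: (linear0 (pack_linear lT)). Qed.

Lemma bounded_op_comp A B : bounded_op A -> bounded_op B -> bounded_op (A \o B).
Proof.
move=> /bounded_opP[lA [C C0 AC]] /bounded_opP[lB [D D0 BD]].
apply/bounded_opP; split=> [a x y /=|]; first by rewrite lB lA.
exists (C * D) => [|x /=]; first exact: mulr_ge0.
by rewrite (le_trans (AC _))// -mulrA ler_wpM2l.
Qed.

(** The codomain is a normed group so as to cover both operators and scalar
    functionals. *)
Lemma closed_null_set (W : normedZmodType R[i]) (f : H -> W) (C : R) :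
  {morph f : x y / x - y} -> 0 <= C -> (forall x, nrm (f x) <= C * nrm x) ->
  closed [set x | f x = 0].
Proof.
move=> fB C0 fC; apply/closed_nrmP => x xK.
apply: nrm0_eq0; apply/le_anti; rewrite nrm_ge0 andbT.
apply/ler_addgt0Pr => e e0; rewrite add0r.
have C1 : 0 < C + 1 by rewrite ltr_wpDl.
have [m fm xm] := xK (e / (C + 1)) (divr_gt0 e0 C1).
have -> : f x = f (x - m) by rewrite fB fm subr0.
move: xm; rewrite ltr_pdivlMr// => /ltW; apply: le_trans.
by rewrite mulrC (le_trans (fC _))// ler_wpM2r ?nrm_ge0// lerDl.
Qed.

End BoundedOperators.

(** * Inner product, projections and Riesz representation *)

Section InnerProduct.
Variables (R : realType) (H : hilbertType R).
Implicit Types (x y z : H) (M : set H) (A B T : H -> H) (a : R[i]).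
Local Open Scope complex_scope.

Lemma dotC x y : hdot x y = Num.conj (hdot y x).
Proof. by rewrite hermC expr0 mul1r. Qed.

Lemma dot_eq0C x y : hdot x y = 0 -> hdot y x = 0.
Proof. by move=> xy; rewrite dotC xy rmorph0. Qed.

Lemma dot_self x : hdot x x = (nrm x ^+ 2)%:C.
Proof. by rewrite hdot_norm nrmE rmorphXn. Qed.

Lemma nrm_dot_self x : nrm (hdot x x) = nrm x ^+ 2.
Proof. by rewrite dot_self nrm_real ger0_norm// sqr_ge0. Qed.

Lemma dot_ext x y : (forall z, hdot z x = hdot z y) -> x = y.
Proof.
move=> xy; apply/subr0_eq/nrm0_eq0/eqP; rewrite -sqrf_eq0; apply/eqP.
by apply: (@complexI R); rewrite -dot_self linearBr /= xy subrr.
Qed.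

Lemma nrm_add_orth x y :
  hdot x y = 0 -> nrm (x + y) ^+ 2 = nrm x ^+ 2 + nrm y ^+ 2.
Proof.
move=> xy; apply: (@complexI R); rewrite rmorphD/= -!dot_self.
by rewrite dnormD xy conjC0 !addr0.
Qed.

Lemma parallelogram x y :
  nrm (x + y) ^+ 2 + nrm (x - y) ^+ 2 = 2 * (nrm x ^+ 2 + nrm y ^+ 2).
Proof.
apply: (@complexI R); rewrite rmorphM rmorph_nat !rmorphD/= -!dot_self dnormD dnormB.
by rewrite mulr_natl mulr2n addrACA subrr addr0.
Qed.

(** The vector c y is the projection of x onto the line spanned by y; the last
    equation is Pythagoras. Cauchy-Schwarz and the orthogonality of nearest
    points are both read off from it. *)
Lemma proj_line x y : y != 0 ->
  let c := hdot x y / hdot y y in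
  [/\ hdot (x - c *: y) y = 0, nrm c * nrm y ^+ 2 = nrm (hdot x y) &
      nrm x ^+ 2 = nrm (x - c *: y) ^+ 2 + (nrm c * nrm y) ^+ 2].
Proof.
move=> y0 c; have yy0 : hdot y y != 0 by rewrite dnorm_eq0.
have xyc : hdot x y = c * hdot y y by rewrite /c divfK.
clearbody c; have xcy : hdot (x - c *: y) y = 0 by rewrite linearBl linearZl_LR/= -xyc subrr.
split => //.
  by rewrite xyc nrmM nrm_dot_self.
have xcy' : hdot (x - c *: y) (c *: y) = 0 by rewrite linearZr_LR /= xcy mulr0.
by rewrite -nrmZ -(nrm_add_orth xcy') subrK.
Qed.

Lemma cauchy_schwarz x y : nrm (hdot x y) <= nrm x * nrm y.
Proof.
have [->|y0] := eqVneq y 0; first by rewrite linear0r /nrm !normr0 /= mulr0.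
have [_ <- xE] := proj_line x y0.
rewrite expr2 mulrA ler_wpM2r ?nrm_ge0//.
rewrite -(@ler_pXn2r _ 2) ?nnegrE ?mulr_ge0 ?nrm_ge0// xE lerDr.
exact: sqr_ge0.
Qed.

Definition linear_subspace M :=
  M 0 /\ forall a x y, M x -> M y -> M (a *: x + y).

Lemma subspaceB M x y : linear_subspace M -> M x -> M y -> M (x - y).
Proof.
by move=> [_ MS] Mx My; rewrite addrC -scaleN1r; exact: MS.
Qed.

Lemma subspaceZ M a x : linear_subspace M -> M x -> M (a *: x).
Proof. by move=> [M0 MS] Mx; rewrite -[_ *: _]addr0; exact: MS. Qed.

Lemma subspaceD M x y : linear_subspace M -> M x -> M y -> M (x + y).
Proof. by move=> [_ MS] Mx My; rewrite -[x]scale1r; exact: MS. Qed.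

Lemma subspace_range T : linear T -> linear_subspace (range T).
Proof.
move=> lT; split; first by exists 0 => //; exact: linear_op0.
by move=> a _ _ [x _ <-] [y _ <-]; exists (a *: x + y) => //; exact: lT.
Qed.

(** Two points m, m' of M almost at the infimum d of the squared distances are
    close to each other: their midpoint is in M, hence at squared distance at
    least d from x, and the parallelogram law bounds |m - m'|^2 by twice the
    total excess over d. *)
Lemma nearest_point M x : closed M -> linear_subspace M ->
  exists2 m, M m & forall y, M y -> nrm (x - m) <= nrm (x - y).
Proof.
move=> /closed_nrmP Mcl Msub; have [M0 _] := Msub.
pose D := [set nrm (x - m) ^+ 2 | m in M].
have D0 : D !=set0 by exists (nrm (x - 0) ^+ 2); exists 0.
have Dlb : has_lbound D by exists 0 => _ [m _ <-]; exact: sqr_ge0.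
pose d := inf D.
have dle m : M m -> d <= nrm (x - m) ^+ 2 by move=> Mm; apply: ge_inf => //; exists m.
have /choice[u uP] n : exists m, M m /\ nrm (x - m) ^+ 2 < d + n.+1%:R^-1.
  have n0 : 0 < n.+1%:R^-1 :> R by rewrite invr_gt0.
  by have [_ [m Mm <-] md] := inf_adherent n0 (conj D0 Dlb); exists m.
have uB n m : nrm (u n - u m) ^+ 2 <= 2 * (n.+1%:R^-1 + m.+1%:R^-1).
  have [[Mn un] [Mm um]] := (uP n, uP m).
  have := parallelogram (x - u n) (x - u m).
  have -> : x - u n - (x - u m) = u m - u n by rewrite opprB addrC subrKA.
  rewrite (nrmBC (u m)).
  have := dle _ (subspaceZ (2^-1) Msub (subspaceD Msub Mn Mm)).
  have -> : x - u n + (x - u m) = 2 *: (x - 2^-1 *: (u n + u m)).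
    rewrite scalerBr scalerA mulfV ?pnatr_eq0// scale1r scaler_nat mulr2n.
    by rewrite opprD addrACA.
  rewrite nrmZ exprMn.
  have -> : nrm (2 : R[i]) = 2.
    by rewrite -[2 in LHS](rmorph_nat (real_complex R)) nrm_real ger0_norm.
  by move: un um; move: (n.+1%:R^-1) (m.+1%:R^-1) => p q; lra.
have [e e0|m um] := @cauchy_nrm_cvg _ H u.
  have /invS_lt[N NP] : 0 < e ^+ 2 / 4 by rewrite divr_gt0 ?exprn_gt0.
  exists N => p q Np Nq; rewrite -(@ltr_pXn2r _ 2) ?nnegrE ?nrm_ge0 ?ltW//.
  have := uB p q; have := NP _ Np; have := NP _ Nq.
  by move: (p.+1%:R^-1) (q.+1%:R^-1) => p' q'; lra.
have Mm : M m.
  apply: Mcl => e e0; have [N NP] := um e e0.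
  by exists (u N); [have [] := uP N|rewrite nrmBC NP].
exists m => // y My; rewrite -(@ler_pXn2r _ 2) ?nnegrE ?nrm_ge0//.
apply: (le_trans _ (dle y My)); rewrite leNgt; apply/negP => dm.
have d0 : 0 <= d by apply: lb_le_inf => // _ [? _ <-]; exact: sqr_ge0.
have v0 : 0 < nrm (x - m).
  by rewrite lt_neqAle nrm_ge0 andbT eq_sym -sqrf_eq0 gt_eqF ?(le_lt_trans d0).
set v := nrm (x - m) in dm v0.
(* With this e, (v - e)^2 still exceeds d by at least half of v^2 - d. *)
pose e := (v ^+ 2 - d) / (4 * v).
have e0 : 0 < e by rewrite divr_gt0 ?subr_gt0 ?mulr_gt0.
have ve : 4 * (v * e) = v ^+ 2 - d by rewrite mulrA /e mulrC divfK ?mulf_neq0 ?gt_eqF.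
have ev : e <= v.
  by rewrite -(ler_pM2l v0) -expr2; have := sqr_ge0 v; lra.
have [N1 NP1] := um _ e0.
have [|N2 NP2] := @invS_lt _ ((v ^+ 2 - d) / 2); first by rewrite divr_gt0 ?subr_gt0.
have [_ uN] := uP (maxn N1 N2).
have := NP2 _ (leq_maxr N1 N2).
have : (v - e) ^+ 2 <= nrm (x - u (maxn N1 N2)) ^+ 2.
  rewrite ler_pXn2r ?nnegrE ?nrm_ge0 ?subr_ge0//.
  have := nrm_dist (u (maxn N1 N2)) x m; have := NP1 _ (leq_maxl N1 N2); rewrite -/v; lra.
by move: uN; move: (_.+1%:R^-1) => p; have := sqr_ge0 e; rewrite sqrrB mulr2n; lra.
Qed.

(** At the nearest point m of x, subtracting from x - m its component along some
    y in M cannot shorten it, so by Pythagoras that component vanishes. *)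
Lemma orthogonal_projection M : closed M -> linear_subspace M ->
  exists P : H -> H, forall x, M (P x) /\ forall y, M y -> hdot (x - P x) y = 0.
Proof.
move=> Mcl Msub.
suff /choice[P PP] x : exists m, M m /\ forall y, M y -> hdot (x - m) y = 0.
  by exists P.
have [m Mm mmin] := nearest_point x Mcl Msub; exists m; split=> // y My.
have [->|y0] := eqVneq y 0; first by rewrite linear0r.
have [_ xyE xE] := proj_line (x - m) y0.
set c := _ / _ in xyE xE.
have : nrm (x - m) ^+ 2 <= nrm (x - m - c *: y) ^+ 2.
  rewrite ler_pXn2r ?nnegrE ?nrm_ge0// -addrA -opprD.
  by apply: mmin; apply: subspaceD => //; exact: subspaceZ.
rewrite xE gerDl => c0; apply: nrm0_eq0.
have /eqP : (nrm c * nrm y) ^+ 2 = 0 by apply/eqP; rewrite eq_le c0 sqr_ge0.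
by rewrite sqrf_eq0 -xyE expr2 mulrA => /eqP ->; rewrite mul0r.
Qed.

(** If f is not zero, pick u orthogonal to its null space with f u != 0. Since
    f(u) y - f(y) u is in the null space, it is orthogonal to u, and solving for
    f(y) shows that a multiple of u represents f. *)
Lemma riesz_representation (f : H -> R[i]) (C : R) :
  (forall a x y, f (a *: x + y) = a * f x + f y) ->
  0 <= C -> (forall x, nrm (f x) <= C * nrm x) ->
  exists z, forall x, f x = hdot x z.
Proof.
move=> fL C0 fC.
have fZ a x : f (a *: x) = a * f x.
  have f0 : f 0 = 0 by apply: nrm0_eq0; apply/le_anti; rewrite nrm_ge0 andbT
    (le_trans (fC 0))// nrm0 mulr0.
  by rewrite -[a *: x]addr0 fL f0 addr0.
have fB x y : f (x - y) = f x - f y by rewrite addrC -scaleN1r fL mulN1r addrC.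
have Kcl := closed_null_set fB C0 fC.
have Ksub : linear_subspace [set x | f x = 0].
  split=> [|a x y /= fx fy]; last by rewrite fL fx fy mulr0 addr0.
  by rewrite /= -(scale0r 0) fZ mul0r.
have [P PK] := orthogonal_projection Kcl Ksub.
have [fE|/existsNP[x fx]] := pselect (forall x, f x = 0).
  by exists 0 => x; rewrite linear0r.
pose u := x - P x.
have fu : f u = f x by rewrite fB (PK x).1 subr0.
have u0 : hdot u u != 0.
  rewrite dnorm_eq0; apply/negP => /eqP u0; apply: fx.
  by rewrite -fu u0 -(scale0r 0) fZ mul0r.
exists (Num.conj (f u / hdot u u) *: u) => y.
rewrite linearZr_LR /= conjCK.
have := (PK x).2 (f u *: y - f y *: u); rewrite -/u /= fB !fZ mulrC subrr.
move=> /(_ erefl)/dot_eq0C; rewrite linearBl !linearZl_LR /= => /eqP.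
by rewrite subr_eq0 => /eqP yu; rewrite mulrAC yu mulfK.
Qed.

End InnerProduct.

(** * Adjoints *)

Section Adjoint.
Variables (R : realType) (H : hilbertType R).
Implicit Types (x y z : H) (M : set H) (A B T S : H -> H) (a : R[i]).

Lemma adjoint_unique A T : bounded_op T ->
  (forall x y, hdot (A x) y = hdot x (T y)) -> adjoint A = T.
Proof.
move=> bT AT; have [] := @getPex _ [set T | bounded_op T /\
  forall x y, hdot (A x) y = hdot x (T y)]; first by exists T.
rewrite -/(adjoint A) => _ AA; apply/funext => y; apply: dot_ext => x.
by rewrite -AA AT.
Qed.

Lemma adjointP A : bounded_op A ->
  bounded_op (adjoint A) /\ forall x y, hdot (A x) y = hdot x (adjoint A y).
Proof.
move=> /bounded_opP[lA [C C0 AC]].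
apply: (@getPex _ [set T | bounded_op T /\
  forall x y, hdot (A x) y = hdot x (T y)]).
have /choice[T AT] y : exists z, forall x, hdot (A x) y = hdot x z.
  apply: (@riesz_representation _ _ _ (C * nrm y)) => [a x x'||x].
    by rewrite lA linearDl linearZl_LR.
    by rewrite mulr_ge0 ?nrm_ge0.
  by rewrite (le_trans (cauchy_schwarz _ _))// mulrAC ler_wpM2r ?nrm_ge0.
exists T; split=> //; apply/bounded_opP; split=> [a y y'|].
  by apply: dot_ext => x; rewrite -AT !linearDr !linearZr_LR /= !AT.
exists C => // y; have [->|Ty0] := eqVneq (T y) 0.
  by rewrite nrm0 mulr_ge0 ?nrm_ge0.
rewrite -(ler_pM2r (nrm_gt0 Ty0)) -expr2 -nrm_dot_self -AT.
by rewrite (le_trans (cauchy_schwarz _ _))// mulrAC ler_wpM2r ?nrm_ge0.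
Qed.

Lemma dot_adjoint A x y : bounded_op A -> hdot (A x) y = hdot x (adjoint A y).
Proof. by move=> /adjointP[]. Qed.

End Adjoint.

(** * Uniform boundedness *)

Section UniformBoundedness.
Variables (R : realType) (H : hilbertType R).
Implicit Types (x y z w : H).
Local Open Scope complex_scope.

(** Let s be the positive multiple of w of norm r. The values of the functional
    <., w> at x + s and x - s differ by 2 <s, w> = 2 r |w|, so one of them has
    modulus at least r |w|. *)
Lemma push_in_direction (r : R) x w : 0 <= r ->
  exists2 x', nrm (x' - x) <= r & r * nrm w <= nrm (hdot x' w).
Proof.
move=> r0; have [->|w0] := eqVneq w 0.
  by exists x; rewrite ?subrr nrm0// mulr0 nrm_ge0.
have nw0 : nrm w != 0 by rewrite gt_eqF ?nrm_gt0.
pose s := (r / nrm w)%:C *: w.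
have sr : nrm s = r.
  by rewrite nrmZ nrm_real ger0_norm ?divr_ge0 ?nrm_ge0// divfK.
have sw : nrm (hdot s w) = r * nrm w.
  rewrite linearZl_LR /= nrmM nrm_dot_self nrm_real ger0_norm ?divr_ge0 ?nrm_ge0//.
  by rewrite expr2 mulrA divfK.
have : 2 * (r * nrm w) <= nrm (hdot (x + s) w) + nrm (hdot (x - s) w).
  have twice : hdot (x + s) w - hdot (x - s) w = 2 * hdot s w.
    by rewrite linearDl linearBl /= opprB addrC subrKA mulr_natl.
  rewrite -sw -[nrm (hdot (x - s) w)]nrmN (le_trans _ (nrmD _ _))// twice nrmM.
  by rewrite -(rmorph_nat (real_complex R)) nrm_real ger0_norm.
have [le1 _|lt1 le2] := leP (r * nrm w) (nrm (hdot (x + s) w)).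
  by exists (x + s) => //; rewrite addrC addKr sr.
exists (x - s); last lra.
by rewrite addrC addKr nrmN sr.
Qed.

(** The uniform boundedness principle, by a gliding hump instead of Baire's
    theorem. If S were unbounded, choose w_n in S with |w_n| > n 3^n and move
    from u_n to u_(n+1) by at most 3^-n so that |<u_(n+1), w_n>| >= 3^-n |w_n|.
    All later steps together move by at most half of 3^-n, so the limit x
    satisfies |<x, w_n>| >= 3^-n |w_n| / 2 > n / 2 for every n. *)
Lemma weakly_bounded_bounded (S : set H) :
  (forall x, exists K : R, forall w, S w -> nrm (hdot x w) <= K) ->
  exists K : R, forall w, S w -> nrm w <= K.
Proof.
move=> Sw; apply: contrapT => /forallNP Sunb.
pose r n : R := 3^-1 ^+ n.
have r0 n : 0 < r n by rewrite exprn_gt0 ?invr_gt0.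
have rS n : 3 * r n.+1 = r n by rewrite /r exprS mulrA mulfV ?mul1r ?pnatr_eq0.
have /choice[w wP] n : exists w, S w /\ n%:R < r n * nrm w.
  have /existsNP[w /not_implyP[Sw' /negP]] := Sunb (n%:R / r n).
  by rewrite -ltNge ltr_pdivrMr// mulrC => nw; exists w.
have /choice[f fP] (p : nat * H) : exists x', nrm (x' - p.2) <= r p.1 /\
    r p.1 * nrm (w p.1) <= nrm (hdot x' (w p.1)).
  by have [x' ? ?] := push_in_direction p.2 (w p.1) (ltW (r0 p.1)); exists x'.
pose u := fix u n := if n is m.+1 then f (m, u m) else 0 : H.
have uS n : nrm (u n.+1 - u n) <= r n := (fP (n, u n)).1.
have uw n : r n * nrm (w n) <= nrm (hdot (u n.+1) (w n)) := (fP (n, u n)).2.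
(* The geometric tail, in a telescoped form that passes through induction. *)
have utail n k : 2 * nrm (u (n + k)%N - u n) <= 3 * r n - 3 * r (n + k)%N.
  elim: k => [|k IH]; first by rewrite addn0 !subrr nrm0 mulr0.
  have := nrm_dist (u (n + k)%N) (u (n + k).+1) (u n); rewrite addnS.
  have := uS (n + k)%N; have := rS (n + k)%N; lra.
have utail' n m : (n <= m)%N -> 2 * nrm (u m - u n) <= 3 * r n.
  by move=> /subnKC <-; have := utail n (m - n)%N; have := r0 (n + (m - n))%N; lra.
have r_le n : r n * n.+1%:R <= 1.
  rewrite /r exprVn mulrC ler_pdivrMr ?exprn_gt0// mul1r -natrX ler_nat.
  by rewrite ltn_expl.
have [e e0|x ux] := @cauchy_nrm_cvg _ H u.
  pose N := Num.truncn (3 / e).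
  have rN : 3 * r N < e.
    have := truncnS_gt (3 / e); rewrite -/N ltr_pdivrMr// => h.
    rewrite -(ltr_pM2r (ltr0Sn R N)) -mulrA; have := r_le N; lra.
  exists N => p q /utail' Np /utail' Nq.
  by have := nrm_dist (u N) (u p) (u q); rewrite (nrmBC (u N)); lra.
have xu n : 2 * nrm (x - u n) <= 3 * r n.
  suff le_e (e : R) : 0 < e -> 2 * nrm (x - u n) <= 3 * r n + e.
    by apply/ler_addgt0Pr => e /le_e.
  move=> e0; have [N uN] := ux (e / 2) (divr_gt0 e0 (ltr0Sn _ 1)).
  have := nrm_dist (u (maxn N n)) x (u n).
  have := utail' _ _ (leq_maxr N n); have := uN _ (leq_maxl N n).
  by rewrite (nrmBC x (u (maxn N n))); lra.
have [K xK] := Sw x.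
pose n := (Num.truncn (2 * `|K|)).+1.
have nK : 2 * K < n%:R by rewrite (le_lt_trans _ (truncnS_gt _))// ler_pM2l ?ler_norm.
have [Swn nw] := wP n.
have uxw : hdot (u n.+1) (w n) = hdot x (w n) + hdot (u n.+1 - x) (w n).
  by rewrite -linearDl addrC subrK.
have := uw n; rewrite uxw => /le_trans /(_ (nrmD _ _)).
have := xK _ Swn; have := cauchy_schwarz (u n.+1 - x) (w n).
have := ler_wpM2r (nrm_ge0 (w n)) (xu n.+1).
by rewrite rS (nrmBC x) -mulrA; lra.
Qed.

End UniformBoundedness.

(** * The Moore-Penrose inverse *)

Section MoorePenrose.
Variables (R : realType) (H : hilbertType R).
Implicit Types (x y z w : H) (M : set H) (A B T S X P : H -> H).

Definition kernel A : set H := [set x | A x = 0].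

Definition orthogonal_to M : set H := fun x => forall y, M y -> hdot x y = 0.

Lemma subspace_kernel A : linear A -> linear_subspace (kernel A).
Proof.
move=> lA; split; first exact: linear_op0.
by move=> a x y; rewrite /kernel /= lA => -> ->; rewrite scaler0 addr0.
Qed.

Lemma closed_kernel A : bounded_op A -> closed (kernel A).
Proof.
move=> /bounded_opP[lA [C C0 AC]].
exact: closed_null_set (linear_opB lA) C0 AC.
Qed.

(** For w in the range of A, <y, w> = <P y, w> = <A x, w> = <x, A* w>, where x
    depends on y only; so the w with |A* w| <= 1 form a weakly bounded set. *)
Lemma adjoint_bounded_below A : bounded_op A -> closed (range A) ->
  exists2 C : R, 0 <= C & forall w, range A w -> nrm w <= C * nrm (adjoint A w).
Proof.
move=> bA Acl; have [lA _] := bA.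
have [/bounded_opP[lA' _] _] := adjointP bA.
have [P PA] := orthogonal_projection Acl (subspace_range lA).
pose S := [set w | range A w /\ nrm (adjoint A w) <= 1].
have [y|K SK] := @weakly_bounded_bounded _ _ S.
  have [x _ Axy] := (PA y).1; exists (nrm x) => w [Aw w1].
  have -> : hdot y w = hdot x (adjoint A w).
    by rewrite -dot_adjoint// Axy; apply/subr0_eq; rewrite -linearBl; exact: (PA y).2.
  by rewrite (le_trans (cauchy_schwarz _ _))// ler_piMr ?nrm_ge0.
exists `|K| => // w Aw; have [A'w|A'w] := eqVneq (adjoint A w) 0.
  suff -> : w = 0 by rewrite nrm0 mulr_ge0 ?nrm_ge0.
  have [x _ Axw] := Aw; apply/eqP; rewrite -(dnorm_eq0 hdot).
  by rewrite -{1}Axw dot_adjoint// A'w linear0r.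
have n0 := nrm_gt0 A'w.
pose c : R[i] := ((nrm (adjoint A w))^-1)%:C%C.
have nc : nrm c = (nrm (adjoint A w))^-1 by rewrite nrm_real ger0_norm// invr_ge0 ltW.
have : S (c *: w).
  split; first exact: subspaceZ (subspace_range lA) Aw.
  by rewrite linear_opZ// nrmZ nc mulVf// gt_eqF.
move=> /SK; rewrite nrmZ nc ler_pdivrMl// mulrC => /le_trans; apply.
by rewrite ler_wpM2r ?ler_norm// ltW.
Qed.

(** Being bounded below on the range of A, the adjoint turns Cauchy sequences of
    images back into Cauchy sequences of arguments. *)
Lemma closed_adjoint_range A : bounded_op A -> closed (range A) ->
  closed [set adjoint A w | w in range A].
Proof.
move=> bA Acl; have [C C0 AC] := adjoint_bounded_below bA Acl.
have [lA _] := bA; have Asub := subspace_range lA.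
have [/bounded_opP[lA' [D D0 A'D]] _] := adjointP bA.
apply/closed_nrmP => z zA.
have /choice[w wP] n : exists w, range A w /\ nrm (z - adjoint A w) < n.+1%:R^-1.
  have n0 : 0 < n.+1%:R^-1 :> R by rewrite invr_gt0.
  by have [_ [w Aw <-] zw] := zA _ n0; exists w.
have [e e0|l wl] := @cauchy_nrm_cvg _ H w.
  have C1 : 0 < C + 1 by rewrite ltr_wpDl.
  have /invS_lt[N NP] : 0 < e / (C + 1) / 2 by rewrite !divr_gt0.
  exists N => p q Np Nq; have [[Ap zp] [Aq zq]] := (wP p, wP q).
  have Apq : range A (w p - w q) by exact: subspaceB.
  apply: (le_lt_trans (AC _ Apq)); rewrite linear_opB//.
  have : nrm (adjoint A (w p) - adjoint A (w q)) < e / (C + 1).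
    have := nrm_dist z (adjoint A (w p)) (adjoint A (w q)); rewrite (nrmBC _ z).
    have := lt_trans zp (NP _ Np); have := lt_trans zq (NP _ Nq); lra.
  rewrite ltr_pdivlMr//; have := nrm_ge0 (adjoint A (w p) - adjoint A (w q)).
  by rewrite mulrDr mulr1 mulrC; lra.
have Al : range A l.
  move/closed_nrmP: Acl; apply=> e /wl[N wN]; exists (w N); first exact: (wP N).1.
  by rewrite nrmBC wN.
exists l => //; apply/esym/subr0_eq/nrm0_eq0/le_anti; rewrite nrm_ge0 andbT.
suff le_e (e : R) : 0 < e -> nrm (z - adjoint A l) <= e.
  by apply/ler_addgt0Pr => e /le_e; rewrite add0r.
move=> e0; have D1 : 0 < D + 1 by rewrite ltr_wpDl.
have [N1 NP1] := wl _ (divr_gt0 (divr_gt0 e0 (ltr0Sn R 1)) D1).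
have [N2 NP2] := invS_lt (divr_gt0 e0 (ltr0Sn R 1)).
have [_ zw] := wP (maxn N1 N2).
have := lt_trans zw (NP2 _ (leq_maxr N1 N2)).
have := NP1 _ (leq_maxl N1 N2); rewrite ltr_pdivlMr//.
have := nrm_dist (adjoint A (w (maxn N1 N2))) z (adjoint A l).
have := A'D (w (maxn N1 N2) - l); rewrite linear_opB//.
have := nrm_ge0 (w (maxn N1 N2) - l); lra.
Qed.

(** The images A* w with w in the range of A fill the orthogonal complement of
    the kernel: the component x - Q x of x orthogonal to them satisfies
    |A (x - Q x)|^2 = <x - Q x, A* (A (x - Q x))> = 0, so it lies in the kernel
    while being orthogonal to it. *)
Lemma bounded_below_on_coimage A : bounded_op A -> closed (range A) ->
  exists2 C : R, 0 <= C &
    forall x, orthogonal_to (kernel A) x -> nrm x <= C * nrm (A x).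
Proof.
move=> bA Acl; have [C C0 AC] := adjoint_bounded_below bA Acl.
have [lA _] := bA; have Asub := subspace_range lA.
have [/bounded_opP[lA' _] _] := adjointP bA.
pose M := [set adjoint A w | w in range A].
have Msub : linear_subspace M.
  split; first by exists 0; [exact: Asub.1|exact: linear_op0].
  move=> a _ _ [x Ax <-] [y Ay <-]; exists (a *: x + y); last exact: lA'.
  exact: Asub.2.
have [Q QM] := orthogonal_projection (closed_adjoint_range bA Acl) Msub.
exists C => // x xK; have [w Aw wQ] := (QM x).1.
have Qx : Q x = x.
  apply/esym/subr0_eq/eqP; rewrite -(dnorm_eq0 hdot).
  have xQK : kernel A (x - Q x).
    apply/eqP; rewrite -(dnorm_eq0 hdot) dot_adjoint//; apply/eqP/(QM x).2.
    by exists (A (x - Q x)) => //; exists (x - Q x).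
  rewrite linearBl /= (xK _ xQK) sub0r oppr_eq0; apply/eqP/dot_eq0C.
  exact: (QM x).2 (QM x).1.
have [->|x0] := eqVneq x 0; first by rewrite nrm0 mulr_ge0 ?nrm_ge0.
rewrite -(ler_pM2r (nrm_gt0 x0)) -expr2 -nrm_dot_self -[X in hdot _ X]Qx -wQ -dot_adjoint//.
rewrite (le_trans (cauchy_schwarz _ _))// [C * _]mulrC -mulrA ler_wpM2l ?nrm_ge0//.
by rewrite (le_trans (AC _ Aw))// wQ Qx.
Qed.

(** With N and P the projections onto the kernel and the range of A, every x
    can be replaced by x - N x without changing A x, so P y = A (X y) has a
    solution X y orthogonal to the kernel. It is unique, which yields
    linearity of X and both identities AX = P and XA = id - N. *)
Lemma moore_penrose_exists A : bounded_op A -> closed (range A) ->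
  exists X, bounded_op X /\ penrose A X.
Proof.
move=> bA Acl; have [lA _] := bA; have Asub := subspace_range lA.
have [P PA] := orthogonal_projection Acl Asub.
have Ksub := subspace_kernel lA.
have [N NK] := orthogonal_projection (closed_kernel bA) Ksub.
have [C C0 AC] := bounded_below_on_coimage bA Acl.
have Osub : linear_subspace (orthogonal_to (kernel A)).
  split=> [y _|a x y xK yK z Kz]; first by rewrite linear0l.
  by rewrite linearDl linearZl_LR /= xK// yK// mulr0 addr0.
have inj x y : orthogonal_to (kernel A) x -> orthogonal_to (kernel A) y ->
    A x = A y -> x = y.
  move=> xK yK Axy; apply/subr0_eq/nrm0_eq0/le_anti; rewrite nrm_ge0 andbT.
  by rewrite (le_trans (AC _ (subspaceB Osub xK yK)))// linear_opB// Axy subrr nrm0 mulr0.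
have AN x : A (x - N x) = A x by rewrite linear_opB// (NK x).1 subr0.
have NO x : orthogonal_to (kernel A) (x - N x) := (NK x).2.
have /choice[X XP] y : exists x, orthogonal_to (kernel A) x /\ A x = P y.
  by have [x _ <-] := (PA y).1; exists (x - N x).
have XO y := (XP y).1; have AX y : A (X y) = P y := (XP y).2.
have P_uniq y z : range A z -> orthogonal_to (range A) (y - z) -> P y = z.
  move=> Az yz; apply/subr0_eq/eqP; rewrite -(dnorm_eq0 hdot).
  have PzA : range A (P y - z) by apply: subspaceB => //; exact: (PA y).1.
  by rewrite -[X in hdot X _](subrKA y) linearDl /= -opprB linearNl /=
    (PA y).2// yz// oppr0 addr0.
have lP : linear P.
  move=> a x y; apply: P_uniq; first by apply: Asub.2; [exact: (PA x).1|exact: (PA y).1].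
  move=> z Az; rewrite opprD addrACA -scalerBr linearDl linearZl_LR /=.
  by rewrite (PA x).2// (PA y).2// mulr0 addr0.
have bP : bounded_op P.
  apply/bounded_opP; split=> //; exists 1 => // y; rewrite mul1r.
  rewrite -(@ler_pXn2r _ 2) ?nnegrE ?nrm_ge0// -[in leRHS](subrK (P y) y).
  by rewrite nrm_add_orth ?lerDr ?sqr_ge0// (PA y).2//; exact: (PA y).1.
have lX : linear X.
  move=> a x y; apply: inj; [exact: XO|by apply: Osub.2; exact: XO|].
  by rewrite lA !AX lP.
have PA_id x : P (A x) = A x by apply: P_uniq => [|z _]; [exists x|rewrite subrr linear0l].
have XA x : X (A x) = x - N x by apply: inj => //; rewrite AX AN PA_id.
have [_ [D D0 PD]] := (bounded_opP P).1 bP.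
have bX : bounded_op X.
  apply/bounded_opP; split=> //; exists (C * D); first exact: mulr_ge0.
  by move=> y; rewrite (le_trans (AC _ (XO y)))// AX -mulrA ler_wpM2l.
have AXE : A \o X = P by apply/funext => y; exact: AX.
exists X; split=> //; split.
- by apply/funext => x /=; rewrite AX PA_id.
- by apply/funext => y /=; rewrite XA; apply: inj => //; rewrite AN.
- rewrite AXE; apply: adjoint_unique => // x y.
  have Ax := (PA x).1; have Ay := (PA y).1.
  rewrite -[y in LHS](subrK (P y)) -[x in RHS](subrK (P x)) linearDr linearDl /=.
  by rewrite (PA x).2// [X in X + _ = _]dotC (PA y).2// rmorph0 !add0r.
- apply: adjoint_unique => [|x y /=]; first exact: bounded_op_comp.
  rewrite !XA.
  have -> : hdot (x - N x) y = hdot (x - N x) (y - N y).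
    by rewrite [RHS]linearBr /= (NO x _ (NK y).1) subr0.
  by rewrite [LHS]linearBl /= (dot_eq0C (NO y _ (NK x).1)) subr0.
Qed.

Lemma mpinvP A : bounded_op A -> closed (range A) ->
  bounded_op (mpinv A) /\ penrose A (mpinv A).
Proof.
by move=> bA Acl; apply: (@getPex _ [set X | bounded_op X /\ penrose A X]);
  exact: moore_penrose_exists.
Qed.

End MoorePenrose.

(** * Solvability of the system *)

Theorem theorem2p3 (R : realType) (H : hilbertType R) (A B : H -> H)
    (hA : bounded_op A) (hB : bounded_op B) (hBsa : self_adjoint B)
    (hAcl : closed (range A)) :
  [<-> (exists X : H -> H,
          [/\ bounded_op X, B \o X \o A = B & A \o X \o B = B]);
       A \o mpinv A \o B \o mpinv A \o A = B;
       range B `<=` range A /\ range B `<=` range (adjoint A)].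
Proof.
have [bX [AXA XAX AXs XAs]] := mpinvP hA hAcl.
set X := mpinv A in bX AXA XAX AXs XAs *.
have AXAE x : A (X (A x)) = A x := congr1 (fun f => f x) AXA.
have dotB x y : hdot (B x) y = hdot x (B y) by rewrite dot_adjoint// hBsa.
have dotAX x y : hdot (A (X x)) y = hdot x (A (X y)).
  by rewrite (dot_adjoint x y (bounded_op_comp hA bX)) AXs.
have dotXA x y : hdot (X (A x)) y = hdot x (X (A y)).
  by rewrite (dot_adjoint x y (bounded_op_comp bX hA)) XAs.
tfae.
- move=> [Y [_ BYA AYB]].
  have BYAE x : B (Y (A x)) = B x := congr1 (fun f => f x) BYA.
  have AYBE x : A (Y (B x)) = B x := congr1 (fun f => f x) AYB.
  have AXB x : A (X (B x)) = B x by rewrite -[in LHS]AYBE AXAE AYBE.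
  have BXA x : B (X (A x)) = B x by rewrite -BYAE AXAE BYAE.
  by apply/funext => x /=; rewrite AXB BXA.
- move=> AXBXA; have BE x : B x = A (X (B (X (A x)))) by rewrite -[in LHS]AXBXA.
  (* The adjoint of the equation BE. *)
  have BE' y : B y = X (A (B (A (X y)))).
    by apply: dot_ext => x; rewrite -dotB BE dotAX dotB dotXA.
  split=> _ [x _ <-].
    by exists (X (B (X (A x)))) => //; rewrite -BE.
  exists (adjoint X (B (A (X x)))) => //; apply: dot_ext => y.
  by rewrite (BE' x) -!dot_adjoint// dotXA.
- move=> [BA BA']; exists X; split=> //; last first.
    apply/funext => x /=; have [z _ <-] : range A (B x) by apply: BA; exists x.
    exact: AXAE.
  apply/funext => x; apply: dot_ext => y /=; rewrite -!dotB.
  have [z _ <-] : range (adjoint A) (B y) by apply: BA'; exists y.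
  rewrite [LHS]dotC [RHS]dotC -!dot_adjoint//.
  by congr (Num.conj (hdot _ z)); exact: AXAE.
Qed.
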